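(* Let $N$ be an even positive integer and let $$\Gamma=\begin{bmatrix} I_{N/2} & 0\\ 0 & -I_{N/2}\end{bmatrix}\in\mathbb{C}^{N\times N}.$$ Suppose $U\in\mathbb{C}^{N\times N}$ is a unitary matrix with $\Gamma U\Gamma=U^{\dagger}$. Then there are matrices $Q,D\in\mathbb{C}^{N\times N}$ such that $$D=\begin{bmatrix} D_{11} & D_{12}\\ D_{21} & D_{22}\end{bmatrix}$$ has $N/2$-by-$N/2$ blocks $D_{jk}$ that are all diagonal matrices, $Q$ is unitary with $\Gamma Q\Gamma=Q$, and $$U=QDQ^{\dagger}.$$ Moreover, the matrices $Q$ and $D$ can be chosen so that the $N/2$-by-$N/2$ blocks $D_{jk}$ of $D$ are all real diagonal matrices, $Q$ is unitary with $\Gamma Q\Gamma=Q$, and $U=QDQ^{\dagger}$.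
   Context: $X^{\dagger}$ denotes the conjugate transpose of a matrix $X$. *)

(* Defs.v *)
From HB Require Import structures.
From mathcomp Require Import all_boot all_order all_algebra.
From mathcomp Require Import complex.
From mathcomp Require Import reals.

Set Implicit Arguments.
Unset Strict Implicit.
Unset Printing Implicit Defensive.

Import Order.TTheory GRing.Theory Num.Theory.

Local Open Scope ring_scope.

(* An even positive size N is written m + m with 0 < m, so that N / 2 = m and
   2 x 2 block decompositions are those of block_mx. *)

Definition Gamma (C : nzRingType) (m : nat) : 'M[C]_(m + m) :=
  block_mx 1%:M 0 0 (- 1%:M).

Definition all_blocks (C : Type) (m : nat) (P : 'M[C]_m -> bool)
    (D : 'M[C]_(m + m)) : bool :=
  [&& P (ulsubmx D), P (ursubmx D), P (dlsubmx D) & P (drsubmx D)].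

Definition is_real_diag_mx (C : numDomainType) (m : nat) (A : 'M[C]_m) : bool :=
  is_diag_mx A && (A \is a mxOver Num.real).

(* Main.v *)
Require Import Defs.
From HB Require Import structures.
From mathcomp Require Import all_boot all_order all_algebra.
From mathcomp Require Import complex.
From mathcomp Require Import reals.

Set Implicit Arguments.
Unset Strict Implicit.
Unset Printing Implicit Defensive.

Import Order.TTheory GRing.Theory Num.Theory.

Local Open Scope ring_scope.
Local Open Scope sesquilinear_scope.

(** Write U in m-by-m blocks.  The relation between U and Gamma says that
    U = [A, B; -B^*, E] with A and E Hermitian, and the upper right block of
    U U^* = 1 is then A B = B E.  A unitary Q commutes with Gamma exactly when
    it is block diagonal, so the theorem asks for unitary P and S such that
    P A P^*, P B S^* and S E S^* are simultaneously real diagonal: a singular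
    value decomposition of B that diagonalizes A and E as well.

    Such P and S come from the relation A B = B E
    (simultaneous_real_diagonalization).  Together with its adjoint
    B^* A = E B^* it shows that A commutes with B B^*, that B intertwines the
    eigenvectors of A and of E, and that A and E preserve the kernels of B and
    of B^*.  Hence there are unit vectors x, y which are eigenvectors of A and
    E and form a singular pair of B for a real singular value
    (singular_eigenpair).  Completing x and y to orthonormal bases splits a
    1-by-1 block off A, B and E at once (deflation); the remaining blocks
    satisfy the same hypotheses, and induction on the size concludes.

    Vectors are row vectors, acting on matrices from the left.  The real
    decomposition is also a diagonal one, so it settles both halves of the
    theorem. *)

(** * Conjugate transposes and unitary matrices *)

Section SimultaneousReduction.

Context {C : numClosedFieldType}.

Lemma trmxC_mul m n p (A : 'M[C]_(m, n)) (B : 'M[C]_(n, p)) :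
  (A *m B)^t* = B^t* *m A^t*.
Proof. by rewrite trmx_mul map_mxM. Qed.

Lemma trmxC_block m1 m2 n1 n2 (A : 'M[C]_(m1, n1)) (B : 'M[C]_(m1, n2))
    (A' : 'M[C]_(m2, n1)) (B' : 'M[C]_(m2, n2)) :
  (block_mx A B A' B')^t* = block_mx (A^t*) (A'^t*) (B^t*) (B'^t*).
Proof. by rewrite tr_block_mx map_block_mx. Qed.

Lemma trmxC_scale m n (a : C) (A : 'M[C]_(m, n)) :
  (a *: A)^t* = Num.conj a *: A^t*.
Proof. by apply/matrixP=> i j; rewrite !mxE rmorphM. Qed.

Lemma unitarymx_tmul n (P : 'M[C]_n) : P \is unitarymx -> P^t* *m P = 1%:M.
Proof. by move=> /unitarymxP /mulmx1C. Qed.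

Lemma block_diag_unitary m n (P : 'M[C]_m) (Q : 'M[C]_n) :
  P \is unitarymx -> Q \is unitarymx -> block_mx P 0 0 Q \is unitarymx.
Proof.
move=> /unitarymxP PP /unitarymxP QQ; apply/unitarymxP.
rewrite trmxC_block mulmx_block !trmx0 !map_mx0.
by rewrite !(mulmx0, mul0mx, addr0, add0r) PP QQ -scalar_mx_block.
Qed.

Lemma normalize_row n (v : 'rV[C]_n) : v != 0 ->
  exists2 c : C, 0 < c & (c *: v) *m (c *: v)^t* = 1%:M.
Proof.
move=> v0; have d_gt0 := dotmx_is_dotmx v0; set d := dotmx v v in d_gt0.
exists (sqrtC d)^-1; first by rewrite invr_gt0 sqrtC_gt0.
have vv : v *m v^t* = d%:M by rewrite [LHS]mx11_scalar -dotmxE.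
have c_gt0 : 0 < (sqrtC d)^-1 by rewrite invr_gt0 sqrtC_gt0.
rewrite trmxC_scale -scalemxAl -scalemxAr scalerA vv scale_scalar_mx.
rewrite (geC0_conj (ltW c_gt0)) -invfM -expr2 sqrtCK mulVf //.
by rewrite gt_eqF.
Qed.

(** The Gram-Schmidt process applied to x followed by zero rows.  Its first row
    r spans the line of x; the process moreover makes the product of x and r
    nonnegative, so that r is x itself and not another unit multiple of it. *)
Lemma unit_row_completion n (x : 'rV[C]_(1 + n)) : x *m x^t* = 1%:M ->
  exists2 P : 'M[C]_(1 + n), P \is unitarymx & usubmx P = x.
Proof.
move=> xx; pose S : 'M[C]_(1 + n) := col_mx x 0.
exists (schmidt S); first by rewrite schmidt_unitarymx.
have S_unit : schmidt S \is unitarymx by rewrite schmidt_unitarymx.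
set r := usubmx (schmidt S).
have rE : row 0 (schmidt S) = r.
  by apply/rowP=> j; rewrite !mxE; congr (schmidt S _ _); apply/val_inj.
have SE : row 0 S = x.
  apply/rowP=> j; rewrite !mxE; case: splitP => // k _.
  by rewrite ord1.
have /sub_rVP[c xE] : (x <= r)%MS.
  have := row_schmidt_sub S 0; rewrite SE -rE.
  rewrite (bigD1 ord0) //= big1 ?addsmx0 ?genmxE //.
  by move=> k /andP[]; rewrite leqn0 -val_eqE /= => ->.
have rr : r *m r^t* = 1%:M.
  have /row_unitarymxP/(_ 0 0) := S_unit.
  by rewrite rE dotmxE /= => rr0; rewrite [LHS]mx11_scalar rr0.
have c_ge0 : 0 <= c.
  have := form1_row_schmidt S 0.
  by rewrite SE rE xE dotmxE -scalemxAl rr !mxE mulr1.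
have c1 : c * c = 1.
  move: xx; rewrite xE trmxC_scale -scalemxAl -scalemxAr scalerA rr.
  rewrite (geC0_conj c_ge0) => /matrixP/(_ 0 0).
  by rewrite !mxE mulr1.
suff -> : x = r by [].
rewrite xE; suff -> : c = 1 by rewrite scale1r.
by apply/eqP; rewrite -(@pexpr_eq1 _ _ 2) // expr2 c1.
Qed.

(** * Eigenvectors adapted to A, B and E *)

Lemma stable_eigenvector m n (V : 'M[C]_(m, n)) (A : 'M[C]_n) :
  V != 0 -> stablemx V A ->
  exists2 v : 'rV[C]_n, v != 0 & (v <= V)%MS /\ exists a, v *m A = a *: v.
Proof.
move=> V0 VA.
have [|a /eigenvalueP[w wa w0]] := eigenvalue_closed (restrictmx V A).
  by rewrite lt0n mxrank_eq0.
exists (w *m row_base V); first by rewrite mulmx_free_eq0 ?row_base_free.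
split; first by rewrite mulmx_sub // eq_row_base.
exists a.
have RA : (row_base V *m A <= row_base V)%MS by rewrite stablemx_row_base.
rewrite -mulmxA -(mulmxKpV RA) mulmxA scalemxAl -wa.
by rewrite /conjmx !mulmxA.
Qed.

Lemma hermitian_eigenvalue_real n (A : 'M[C]_n) (x : 'rV[C]_n) a :
  A^t* = A -> x *m x^t* = 1%:M -> x *m A = a *: x -> a \is Num.real.
Proof.
move=> AH xx xA; apply/CrealP.
have aE : x *m A *m x^t* = a%:M by rewrite xA -scalemxAl xx scalemx1.
have := congr1 (fun N : 'M_1 => (N^t*) 0 0) aE.
by rewrite !trmxC_mul trmxCK AH mulmxA aE !mxE /= mulr1n.
Qed.

Lemma commuting_coadjoint n (A B E : 'M[C]_n) :
  A^t* = A -> E^t* = E -> A *m B = B *m E -> B^t* *m A = E *m B^t*.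
Proof.
by move=> AH EH AB; rewrite -[A in LHS]AH -trmxC_mul AB trmxC_mul EH.
Qed.

(** If B is invertible, take a common eigenvector x of the commuting matrices A
    and B B^*, and let y be the normalization of x B; then A B = B E carries the
    eigenvalue equation of x over to y.  If B is singular, so is B^*, and both
    kernels are nonzero; A preserves the first and E the second, so x and y can
    be chosen there independently, with singular value 0.  In that case their
    eigenvalues need not agree. *)
Lemma singular_eigenpair n (A B E : 'M[C]_n) : (0 < n)%N ->
  A^t* = A -> E^t* = E -> A *m B = B *m E ->
  exists x y : 'rV[C]_n, exists a e b : C,
    [/\ x *m x^t* = 1%:M /\ y *m y^t* = 1%:M,
        b \is Num.real,
        x *m A = a *: x, y *m E = e *: y
      & x *m B = b *: y /\ y *m B^t* = b *: x].
Proof.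
move=> n_gt0 AH EH AB; have BA := commuting_coadjoint AH EH AB.
have [Bunit|Bsing] := boolP (B \in unitmx).
  have comm : A *m (B *m B^t*) = B *m B^t* *m A.
    by rewrite mulmxA AB -!mulmxA BA.
  have [v v0 /andP[vA vBB]] := common_eigenvector2 n_gt0 comm.
  have [c c_gt0] := normalize_row v0; set x := c *: v => xx.
  have [a vAE] : exists a, v *m A = a *: v by apply/sub_rVP.
  have [s vBE] : exists s, v *m (B *m B^t*) = s *: v by apply/sub_rVP.
  have xA : x *m A = a *: x by rewrite -scalemxAl vAE !scalerA mulrC.
  have xBB : x *m (B *m B^t*) = s *: x by rewrite -scalemxAl vBE !scalerA mulrC.
  have x0 : x != 0 by rewrite scaler_eq0 gt_eqF.
  have xB0 : x *m B != 0.
    by apply: contra_neq x0 => xB0; rewrite -[x](mulmxK Bunit) xB0 mul0mx.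
  have [d d_gt0] := normalize_row xB0; set y := d *: (x *m B) => yy.
  have d0 : d != 0 by rewrite gt_eqF.
  have xB : x *m B = d^-1 *: y by rewrite scalerA mulVf ?scale1r.
  (* Both sides are the squared norm of x B, computed from B B^* and from y. *)
  have sE : s = d^-1 * d^-1.
    have : x *m B *m (x *m B)^t* = s%:M.
      by rewrite trmxC_mul mulmxA -(mulmxA x) xBB -scalemxAl xx scalemx1.
    rewrite xB trmxC_scale -scalemxAl -scalemxAr scalerA yy scalemx1.
    rewrite (geC0_conj _); last by rewrite invr_ge0 ltW.
    by move/matrixP/(_ 0 0); rewrite !mxE !mulr1n.
  exists x, y, a, a, d^-1; split=> //.
  - by rewrite rpredV gtr0_real.
  - by rewrite -scalemxAl -mulmxA -AB mulmxA xA -scalemxAl scalerA mulrC -scalerA.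
  - split=> //; rewrite -scalemxAl -mulmxA xBB scalerA sE mulrA mulfV //.
    by rewrite mul1r.
have kerB : kermx B != 0 by rewrite kermx_eq0 row_free_unit.
have kerB' : kermx (B^t*) != 0.
  by rewrite kermx_eq0 row_free_unit map_unitmx unitmx_tr.
have kerA : stablemx (kermx B) A.
  by apply/sub_kermxP; rewrite -mulmxA AB mulmxA mulmx_ker mul0mx.
have kerE : stablemx (kermx (B^t*)) E.
  by apply/sub_kermxP; rewrite -mulmxA -BA mulmxA mulmx_ker mul0mx.
have [v v0 [/sub_kermxP vB [a vA]]] := stable_eigenvector kerB kerA.
have [w w0 [/sub_kermxP wB [e wE]]] := stable_eigenvector kerB' kerE.
have [c _ xx] := normalize_row v0; have [d _ yy] := normalize_row w0.
exists (c *: v), (d *: w), a, e, 0; split=> //.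
- by rewrite -scalemxAl vA !scalerA mulrC.
- by rewrite -scalemxAl wE !scalerA mulrC.
- by rewrite -!scalemxAl vB wB !scaler0 !scale0r.
Qed.

(** * Deflation and induction *)

(** The two hypotheses give the first row of N = P M Q^* and that of N^*,
    hence the first column of N.  The same real scalar occurs in both, which
    is why M = A, B and E can be treated alike. *)
Lemma deflation n (P Q M : 'M[C]_(1 + n)) (b : C) :
  P \is unitarymx -> Q \is unitarymx -> b \is Num.real ->
  usubmx P *m M = b *: usubmx Q -> usubmx Q *m M^t* = b *: usubmx P ->
  P *m M *m Q^t* = block_mx b%:M 0 0 (drsubmx (P *m M *m Q^t*)).
Proof.
have row1 (N : 'M[C]_(1 + n)) : usubmx N = b *: usubmx 1%:M ->
    ulsubmx N = b%:M /\ ursubmx N = 0.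
  move=> NE; rewrite /ulsubmx /ursubmx NE.
  rewrite (scalar_mx_block 1 n) /block_mx col_mxKu.
  by rewrite scale_row_mx row_mxKl row_mxKr scalemx1 scaler0.
move=> /unitarymxP PP /unitarymxP QQ b_real PM QM; set N := P *m M *m Q^t*.
have [Nul Nur] : ulsubmx N = b%:M /\ ursubmx N = 0.
  by apply: row1; rewrite -!mul_usub_mx PM -scalemxAl mul_usub_mx QQ.
have [_ Ndl] : ulsubmx (N^t*) = b%:M /\ ursubmx (N^t*) = 0.
  apply: row1; rewrite !trmxC_mul trmxCK mulmxA -!mul_usub_mx QM -scalemxAl.
  by rewrite mul_usub_mx PP.
rewrite -[LHS]submxK Nul Nur; congr block_mx.
by rewrite -[LHS]trmxCK trmx_dlsub map_ursubmx Ndl trmx0 map_mx0.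
Qed.

Lemma real_diag_extend n (D : 'M[C]_n) (b : C) : b \is Num.real ->
  is_real_diag_mx D -> is_real_diag_mx (block_mx b%:M 0 0 D : 'M[C]_(1 + n)).
Proof.
move=> b_real /andP[Ddiag Dreal]; apply/andP; split.
  by rewrite is_diag_block_mx // !eqxx scalar_mx_is_diag Ddiag.
apply/mxOverP=> i j; case: (split_ordP i) => k ->; case: (split_ordP j) => l ->.
- by rewrite block_mxEul mxE rpredMn.
- by rewrite block_mxEur mxE rpred0.
- by rewrite block_mxEdl mxE rpred0.
- by rewrite block_mxEdr (mxOverP Dreal).
Qed.

(** Singular value decomposition of B by bases that diagonalize A and E. *)
Lemma simultaneous_real_diagonalization n (A B E : 'M[C]_n) :
  A^t* = A -> E^t* = E -> A *m B = B *m E ->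
  exists P Q : 'M[C]_n,
    [/\ P \is unitarymx, Q \is unitarymx,
        is_real_diag_mx (P *m A *m P^t*),
        is_real_diag_mx (P *m B *m Q^t*)
      & is_real_diag_mx (Q *m E *m Q^t*)].
Proof.
elim: n A B E => [|n IHn] A B E AH EH AB.
  exists 1%:M, 1%:M.
  have triv (D : 'M[C]_0) : is_real_diag_mx D.
    by apply/andP; split; [apply/is_diag_mxP|apply/mxOverP] => -[].
  by split; rewrite ?triv //; apply/unitarymxP/matrixP => -[].
(* The size is displayed as a sum so that blocks can be split off. *)
move: A B E AH EH AB; rewrite -[n.+1]/(1 + n)%N => A B E AH EH AB.
have [//|x [y [a [e [b [[xx yy] b_real xA yE [xB yB]]]]]]] :=
  @singular_eigenpair (1 + n) A B E _ AH EH AB.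
have a_real := hermitian_eigenvalue_real AH xx xA.
have e_real := hermitian_eigenvalue_real EH yy yE.
have [P Pu Px] := unit_row_completion xx.
have [Q Qu Qy] := unit_row_completion yy.
have PAP : P *m A *m P^t* = block_mx a%:M 0 0 (drsubmx (P *m A *m P^t*)).
  by apply: deflation; rewrite ?Px ?AH.
have QEQ : Q *m E *m Q^t* = block_mx e%:M 0 0 (drsubmx (Q *m E *m Q^t*)).
  by apply: deflation; rewrite ?Qy ?EH.
have PBQ : P *m B *m Q^t* = block_mx b%:M 0 0 (drsubmx (P *m B *m Q^t*)).
  by apply: deflation; rewrite ?Px ?Qy.
move: PAP QEQ PBQ; set A1 := drsubmx _; set E1 := drsubmx _.
set B1 := drsubmx _ => PAP QEQ PBQ.
have A1H : A1^t* = A1.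
  have : (P *m A *m P^t*)^t* = P *m A *m P^t*.
    by rewrite !trmxC_mul trmxCK AH mulmxA.
  by rewrite PAP trmxC_block => /eq_block_mx[].
have E1H : E1^t* = E1.
  have : (Q *m E *m Q^t*)^t* = Q *m E *m Q^t*.
    by rewrite !trmxC_mul trmxCK EH mulmxA.
  by rewrite QEQ trmxC_block => /eq_block_mx[].
have A1B1 : A1 *m B1 = B1 *m E1.
  have : P *m A *m P^t* *m (P *m B *m Q^t*) = P *m B *m Q^t* *m (Q *m E *m Q^t*).
    by rewrite !mulmxA !mulmxKtV // -!(mulmxA P) AB.
  rewrite PAP PBQ QEQ !mulmx_block => /eq_block_mx[_ _ _].
  by rewrite !(mulmx0, mul0mx, add0r).
have [P1 [Q1 [P1u Q1u dA dB dE]]] := IHn A1 B1 E1 A1H E1H A1B1.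
pose ext (S : 'M[C]_n) : 'M[C]_(1 + n) := block_mx 1%:M 0 0 S.
have ext_unitary S : S \is unitarymx -> ext S \is unitarymx.
  by apply: block_diag_unitary; apply/unitarymxP; rewrite mul1mx trmx1 map_mx1.
(* Used three times below: with P2, Q2 equal to P, P for A, P, Q for B, and
   Q, Q for E. *)
have ext_diag S T M P2 Q2 N c : c \is Num.real ->
    P2 *m M *m Q2^t* = block_mx c%:M 0 0 N ->
    is_real_diag_mx (S *m N *m T^t*) ->
    is_real_diag_mx (ext S *m P2 *m M *m (ext T *m Q2)^t*).
  move=> c_real MN SNT; rewrite trmxC_mul.
  have -> : ext S *m P2 *m M *m (Q2^t* *m (ext T)^t*)
          = ext S *m (P2 *m M *m Q2^t*) *m (ext T)^t* by rewrite !mulmxA.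
  rewrite MN /ext trmxC_block !mulmx_block trmx1 map_mx1 !trmx0 !map_mx0.
  rewrite !(mulmx0, mul0mx, mulmx1, mul1mx, addr0, add0r).
  exact: real_diag_extend.
exists (ext P1 *m P), (ext Q1 *m Q); split.
- by rewrite mul_unitarymx ?ext_unitary.
- by rewrite mul_unitarymx ?ext_unitary.
- exact: ext_diag PAP dA.
- exact: ext_diag PBQ dB.
- exact: ext_diag QEQ dE.
Qed.

Lemma real_diag_opp_adjoint n (D : 'M[C]_n) :
  is_real_diag_mx D -> is_real_diag_mx (- D^t*).
Proof.
move=> /andP[/is_diag_mxP Ddiag /mxOverP Dreal]; apply/andP; split.
  by apply/is_diag_mxP=> i j ij; rewrite !mxE Ddiag ?conjC0 ?oppr0 // eq_sym.
by apply/mxOverP=> i j; rewrite !mxE rpredN conj_Creal.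
Qed.

(** * The role of Gamma *)

Lemma Gamma_conj_block m (A B B' E : 'M[C]_m) :
  Gamma C m *m block_mx A B B' E *m Gamma C m = block_mx A (- B) (- B') E.
Proof.
rewrite /Gamma !mulmx_block !(mulmx0, mul0mx, mulmx1, mul1mx, addr0, add0r).
by rewrite !(mulmxN, mulNmx, mulmx1, mul1mx, opprK).
Qed.

(** The symmetry of U makes A and E Hermitian and turns the upper right block of
    U U^* = 1 into the intertwining relation A B = B E. *)
Lemma Gamma_unitary_real_diagonalization m (U : 'M[C]_(m + m)) :
  U \is unitarymx -> Gamma C m *m U *m Gamma C m = U^t* ->
  exists Q D : 'M[C]_(m + m),
    [/\ all_blocks (@is_real_diag_mx _ m) D,
        Q \is unitarymx,
        Gamma C m *m Q *m Gamma C m = Q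
      & U = Q *m D *m Q^t*].
Proof.
rewrite -[U]submxK; set A := ulsubmx U; set B := ursubmx U.
set B' := dlsubmx U; set E := drsubmx U => /unitarymxP.
rewrite Gamma_conj_block trmxC_block => UU /eq_block_mx[AH BH B'H EH].
have B'E : B' = - B^t* by rewrite -B'H opprK.
have AB : A *m B = B *m E.
  move: UU; rewrite -BH -EH mulmx_block scalar_mx_block => /eq_block_mx[_ + _ _].
  by rewrite mulmxN addrC => /eqP; rewrite subr_eq0 => /eqP.
have [P [S [Pu Su dA dB dE]]] :=
  simultaneous_real_diagonalization (esym AH) (esym EH) AB.
exists (block_mx (P^t*) 0 0 (S^t*)),
  (block_mx (P *m A *m P^t*) (P *m B *m S^t*)
            (- (P *m B *m S^t*)^t*) (S *m E *m S^t*)).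
split.
- rewrite /all_blocks block_mxKul block_mxKur block_mxKdl block_mxKdr.
  by rewrite dA dB dE real_diag_opp_adjoint.
- by rewrite block_diag_unitary // trmxC_unitary.
- by rewrite Gamma_conj_block !oppr0.
- have PP := unitarymx_tmul Pu; have SS := unitarymx_tmul Su.
  rewrite trmxC_block !trmx0 !map_mx0 !mulmx_block.
  rewrite !(mulmx0, mul0mx, addr0, add0r) !trmxCK !trmxC_mul trmxCK.
  rewrite mulmxN mulNmx !mulmxA PP SS !mul1mx.
  by rewrite -!mulmxA PP SS !mulmx1 B'E.
Qed.

End SimultaneousReduction.

Local Open Scope complex_scope.

Theorem theorem3p3 (R : realType) (m : nat) (U : 'M[R[i]]_(m + m))
    (m_gt0 : (0 < m)%N)
    (U_unitary : U \is unitarymx)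
    (GUG : Gamma R[i] m *m U *m Gamma R[i] m = U^t*) :
  (exists Q D : 'M[R[i]]_(m + m),
     [/\ all_blocks (@is_diag_mx _ m m) D,
         Q \is unitarymx,
         Gamma R[i] m *m Q *m Gamma R[i] m = Q
       & U = Q *m D *m Q^t*])
  /\
  (exists Q D : 'M[R[i]]_(m + m),
     [/\ all_blocks (@is_real_diag_mx _ m) D,
         Q \is unitarymx,
         Gamma R[i] m *m Q *m Gamma R[i] m = Q
       & U = Q *m D *m Q^t*]).
Proof.
have [Q [D [Dreal Qu GQ UE]]] := Gamma_unitary_real_diagonalization U_unitary GUG.
split; exists Q, D; split=> //.
by have /and4P[/andP[? _] /andP[? _] /andP[? _] /andP[? _]] := Dreal; apply/and4P.
Qed.
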